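(* Work in 3-dimensional Euclidean space $\mathbb{R}^3$, hyperbolic space $H^3$, or elliptic space $\mathbb{RP}^3$. Let $a_1,a_2,a_3$ and $b_1,b_2,b_3$ be two triples of lines, in general position subject to the condition that the lines $S(a_1,b_1)$, $S(a_2,b_2)$ and $S(a_3,b_3)$ share a skewer. Then the three lines $$S(S(a_1,a_2),S(b_1,b_2)),\quad S(S(a_1,a_3),S(b_1,b_3)),\quad S(S(a_2,a_3),S(b_2,b_3))$$ also share a skewer, i.e. there is a line that intersects all three of them at right angle.
   Context: A skewer of two lines is a line that intersects both of them at right angle; $S(a,b)$ denotes the skewer of $a$ and $b$. Several lines share a skewer if some line intersects each of them at right angle. Elliptic space $\mathbb{RP}^3$ is the quotient of the unit sphere $S^3\subset\mathbb{R}^4$ by the antipodal map; a line $\ell$ is the projectivization of a 2-plane in $\mathbb{R}^4$ and its dual line $\ell^*$ is the projectivization of the orthogonal complement of that plane. In $\mathbb{RP}^3$ a generic pair of lines has exactly two skewers, dual to each other. There ''unique'' means unique up to replacing the skewer by its dual, $S(a,b)$ is either of the two, and the statement is asserted for any choice. General position: each time one needs to draw a skewer of two lines, this operation is well defined and unique (in elliptic space, up to duality). This is required for every expression $S(\cdot,\cdot)$ in the statement and for the common skewer in the conclusion, i.e. some two of the three concluding lines have a unique skewer. It holds on a Zariski open subset of the set of initial data. *)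

(* Defs.v *)
From HB Require Import structures.
From mathcomp Require Import all_boot all_order all_algebra generic_quotient.
From mathcomp Require Import classical_sets reals.

Set Implicit Arguments.
Unset Strict Implicit.
Unset Printing Implicit Defensive.

Import Order.TTheory GRing.Theory Num.Theory.

Local Open Scope classical_set_scope.
Local Open Scope ring_scope.

Definition dot (R : realType) (n : nat) (x y : 'rV[R]_n) : R :=
  \sum_(i < n) x 0 i * y 0 i.

(* Signature (-, +, +, +), coordinate 0 being the timelike one. *)
Definition lorentz (R : realType) (x y : 'rV[R]_4) : R :=
  - (x 0 0 * y 0 0) + \sum_(i < 4 | i != 0) x 0 i * y 0 i.

Inductive geometry := Euclidean | Hyperbolic | Elliptic.

Section Euclidean.
Variable R : realType.
Implicit Types l m : set 'rV[R]_3.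

Definition euclidean_line_at (p v : 'rV[R]_3) : set 'rV[R]_3 :=
  [set p + t *: v | t in [set: R]].

Definition is_euclidean_line l :=
  exists p v : 'rV[R]_3, v != 0 /\ l = euclidean_line_at p v.

Definition euclidean_right_angle l m :=
  exists p u v : 'rV[R]_3,
    [/\ u != 0, v != 0, dot u v = 0,
        l = euclidean_line_at p u & m = euclidean_line_at p v].

End Euclidean.

Section Hyperbolic.
Variable R : realType.

(* The hyperboloid model of H^3. *)
Definition hyperboloid : Type :=
  {x : 'rV[R]_4 | (lorentz x x == -1) && (0 < x 0 0)}.

Implicit Types l m : set hyperboloid.

(* The tangent space at p is the Lorentz-orthogonal complement of p, on which
   the Lorentz form restricts to the (positive definite) Riemannian metric. *)
Definition hyperbolic_tangent (p : hyperboloid) (v : 'rV[R]_4) :=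
  lorentz (val p) v = 0.

Definition hyperbolic_line_at (p : hyperboloid) (v : 'rV[R]_4) :
    set hyperboloid :=
  [set x | val x \in <<[:: val p; v]>>%VS].

Definition is_hyperbolic_line l :=
  exists (p : hyperboloid) (v : 'rV[R]_4),
    [/\ hyperbolic_tangent p v, v != 0 & l = hyperbolic_line_at p v].

Definition hyperbolic_right_angle l m :=
  exists (p : hyperboloid) (u v : 'rV[R]_4),
    [/\ hyperbolic_tangent p u /\ u != 0, hyperbolic_tangent p v /\ v != 0,
        lorentz u v = 0,
        l = hyperbolic_line_at p u & m = hyperbolic_line_at p v].

End Hyperbolic.

Section Elliptic.
Variable R : realType.

Definition sphere3 : Type := {x : 'rV[R]_4 | dot x x == 1}.

Definition antipodal : rel sphere3 :=
  fun x y => (val x == val y) || (val x == - val y).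

Lemma antipodal_refl : reflexive antipodal.
Proof. by move=> x; rewrite /antipodal eqxx. Qed.

Lemma antipodal_sym : symmetric antipodal.
Proof.
by move=> x y; rewrite /antipodal -eqr_oppLR eq_sym [- val x == _]eq_sym.
Qed.

Lemma antipodal_trans : transitive antipodal.
Proof.
move=> y x z; rewrite /antipodal.
by move=> /orP[]/eqP-> /orP[]/eqP->; rewrite ?opprK eqxx ?orbT.
Qed.

Canonical antipodal_equiv :=
  EquivRel antipodal antipodal_refl antipodal_sym antipodal_trans.

Definition RP3 : Type := {eq_quot antipodal}%qT.

Definition RP3_pi (x : sphere3) : RP3 := (\pi_({eq_quot antipodal}) x)%qT.

Implicit Types l m : set RP3.

Definition projectivization (W : {vspace 'rV[R]_4}) : set RP3 :=
  [set RP3_pi x | x in [set x : sphere3 | val x \in W]].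

Definition is_elliptic_line l :=
  exists W : {vspace 'rV[R]_4}, \dim W = 2 /\ l = projectivization W.

(* If l is the projectivization of a plane W, then dual_line l is that of the
   orthogonal complement of W: the unit vectors of W span W. *)
Definition dual_line l : set RP3 :=
  [set RP3_pi y | y in
    [set y : sphere3 | forall x : sphere3, l (RP3_pi x) ->
       dot (val x) (val y) = 0]].

Definition elliptic_tangent (p : sphere3) (v : 'rV[R]_4) := dot (val p) v = 0.

Definition elliptic_line_at (p : sphere3) (v : 'rV[R]_4) : set RP3 :=
  projectivization <<[:: val p; v]>>%VS.

(* The tangent space of RP3 at the class of p is identified with the one of the
   sphere at p; the antipodal map acts by v |-> - v, so the choice of the
   representative p does not affect orthogonality. *)
Definition elliptic_right_angle l m :=
  exists (p : sphere3) (u v : 'rV[R]_4),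
    [/\ elliptic_tangent p u /\ u != 0, elliptic_tangent p v /\ v != 0,
        dot u v = 0,
        l = elliptic_line_at p u & m = elliptic_line_at p v].

End Elliptic.

Definition space_point (R : realType) (X : geometry) : Type :=
  match X with
  | Euclidean => 'rV[R]_3
  | Hyperbolic => hyperboloid R
  | Elliptic => RP3 R
  end.

Section Skewers.
Variables (R : realType) (X : geometry).

Definition is_line : set (space_point R X) -> Prop :=
  match X return set (space_point R X) -> Prop with
  | Euclidean => @is_euclidean_line R
  | Hyperbolic => @is_hyperbolic_line R
  | Elliptic => @is_elliptic_line R
  end.

Definition meets_at_right_angle :
    set (space_point R X) -> set (space_point R X) -> Prop :=
  match X return set (space_point R X) -> set (space_point R X) -> Prop with
  | Euclidean => @euclidean_right_angle R
  | Hyperbolic => @hyperbolic_right_angle R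
  | Elliptic => @elliptic_right_angle R
  end.

Definition same_skewer :
    set (space_point R X) -> set (space_point R X) -> Prop :=
  match X return set (space_point R X) -> set (space_point R X) -> Prop with
  | Euclidean | Hyperbolic => fun s t => s = t
  | Elliptic => fun s t => s = t \/ s = dual_line t
  end.

Implicit Types a b c s : set (space_point R X).

Definition is_skewer a b s :=
  [/\ is_line s, meets_at_right_angle s a & meets_at_right_angle s b].

(* The operation S(a, b) is well defined and s is (a choice of) S(a, b): s is a
   skewer of a and b, and the only one, up to duality in elliptic space. *)
Definition is_S a b s :=
  is_skewer a b s /\ forall t, is_skewer a b t -> same_skewer t s.

Definition has_unique_skewer a b := exists s, is_S a b s.

Definition share_skewer a b c :=
  exists s, [/\ is_line s, meets_at_right_angle s a, meets_at_right_angle s b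
              & meets_at_right_angle s c].

End Skewers.

(* Main.v *)
Require Import Defs.
From HB Require Import structures.
From mathcomp Require Import all_boot all_order all_algebra generic_quotient.
From mathcomp Require Import classical_sets reals ring lra.

Set Implicit Arguments.
Unset Strict Implicit.
Unset Printing Implicit Defensive.

Import Order.TTheory GRing.Theory Num.Theory.

Local Open Scope ring_scope.

(** The three geometries become one once lines are described by vectors over the
    ring A = R[j] with j ^ 2 = s, where s = -1, 0, 1 in the hyperbolic,
    Euclidean and elliptic case (complex, dual and split-complex numbers). A line
    has Pluecker coordinates, a direction a and a moment b in R^3, and is sent to
    the vector a + j b of A^3, considered up to units of A. The two conditions
    for lines with vectors v and w to meet at a right angle, incidence and
    orthogonality, are the imaginary and the real part of the single equation
    v . w = 0. Hence the skewer of two lines is their cross product, and the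
    triple product of three lines with a common skewer vanishes.

    In this dictionary the claim is the theorem of Desargues, seen as an
    identity between polynomials ([desargues]): the triple product of the
    vectors (a_i x a_j) x (b_i x b_j) is, up to sign, the product of the triple
    products of the a_i, of the b_i and of the a_i x b_i. The common skewer of
    the S(a_i, b_i) makes the last factor zero, so the triple product on the
    left is zero; the skewer of a pair of the concluding lines that has only one
    is then orthogonal to the third line as well ([skewer_desargues]).

    Two points need care. First, A may have zero divisors: the cross product of
    the vectors of a and b is a vector of their skewer only if the factor
    between the two is a unit. This is what uniqueness provides: a
    factor killed by some nonzero z would allow the skewer to be turned
    into a different one ([skewer_cross]). Second, the dictionary has to be
    established ([line_coordinates]). The hyperbolic and the elliptic case are
    both about planes in R^4 with the form s x0 y0 + x1 y1 + x2 y2 + x3 y3; they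
    are treated together ([quadric_coordinates]), duality of elliptic lines
    being multiplication by j. *)

(** * Cross products over a commutative ring *)

Section VectorAlgebra.
Variable A : comNzRingType.
Implicit Types u v w t : 'rV[A]_3.

Definition row3 (a b c : A) : 'rV[A]_3 := \row_i nth 0 [:: a; b; c] i.

Definition sprod u v : A := \sum_(i < 3) u 0 i * v 0 i.

Definition cross u v := row3
  (u 0 1 * v 0 2%:R - u 0 2%:R * v 0 1)
  (u 0 2%:R * v 0 0 - u 0 0 * v 0 2%:R)
  (u 0 0 * v 0 1 - u 0 1 * v 0 0).

Definition triple u v w := sprod u (cross v w).

Lemma sum3E (f : 'I_3 -> A) : \sum_i f i = f 0 + f 1 + f 2%:R.
Proof.
rewrite !big_ord_recl big_ord0 addr0 addrA.
by congr (f _ + f _ + f _); apply: val_inj.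
Qed.

Lemma row3_ext u v :
  u 0 0 = v 0 0 -> u 0 1 = v 0 1 -> u 0 2%:R = v 0 2%:R -> u = v.
Proof.
move=> e0 e1 e2; apply/rowP => -[[|[|[|//]]] i3].
- by rewrite (_ : Ordinal i3 = 0) //; apply: val_inj.
- by rewrite (_ : Ordinal i3 = 1) //; apply: val_inj.
- by rewrite (_ : Ordinal i3 = 2%:R) //; apply: val_inj.
Qed.

Lemma row3E a b c :
  (row3 a b c 0 0 = a) * (row3 a b c 0 1 = b) * (row3 a b c 0 2%:R = c).
Proof. by rewrite !mxE. Qed.

Lemma sprodE u v :
  sprod u v = u 0 0 * v 0 0 + u 0 1 * v 0 1 + u 0 2%:R * v 0 2%:R.
Proof. exact: sum3E. Qed.

End VectorAlgebra.

Local Ltac vring :=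
  first [apply: row3_ext | idtac];
  rewrite ?/triple ?/cross ?sprodE; rewrite ?(row3E, mxE) /=; ring.

Section VectorIdentities.
Variable A : comNzRingType.
Implicit Types u v w t : 'rV[A]_3.

Lemma sprodC u v : sprod u v = sprod v u.
Proof. vring. Qed.
Lemma sprodDl u v w : sprod (u + v) w = sprod u w + sprod v w.
Proof. vring. Qed.
Lemma sprodZl a u v : sprod (a *: u) v = a * sprod u v.
Proof. vring. Qed.
Lemma crossZl a u v : cross (a *: u) v = a *: cross u v.
Proof. vring. Qed.
Lemma crossZr a u v : cross u (a *: v) = a *: cross u v.
Proof. vring. Qed.
Lemma crossC u v : cross u v = - cross v u.
Proof. vring. Qed.
Lemma bac_cab u v w : cross u (cross v w) = sprod u w *: v - sprod u v *: w.
Proof. vring. Qed.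
Lemma crossDl u v w : cross (u + v) w = cross u w + cross v w.
Proof. vring. Qed.
Lemma crossvv u : cross u u = 0.
Proof. vring. Qed.
Lemma sprod_crossl u v : sprod u (cross u v) = 0.
Proof. vring. Qed.
Lemma sprod_crossr u v : sprod v (cross u v) = 0.
Proof. vring. Qed.
Lemma tripleC u v w : triple u v w = triple v w u.
Proof. vring. Qed.
Lemma lagrange u v :
  sprod (cross u v) (cross u v) = sprod u u * sprod v v - sprod u v ^+ 2.
Proof. vring. Qed.
Lemma tripleZ a b c u v w :
  triple (a *: u) (b *: v) (c *: w) = a * b * c * triple u v w.
Proof. vring. Qed.
Lemma sprod0l v : sprod 0 v = 0.
Proof. vring. Qed.

Lemma sprodDr u v w : sprod u (v + w) = sprod u v + sprod u w.
Proof. vring. Qed.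
Lemma sprodZr a u v : sprod u (a *: v) = a * sprod u v.
Proof. vring. Qed.

(** Expansion of a multiple of t in the reciprocal basis of u, v, w: a vector
    orthogonal to all three is killed by their triple product. *)
Lemma triple_expand u v w t :
  triple u v w *: t = sprod t u *: cross v w + sprod t v *: cross w u
    + sprod t w *: cross u v.
Proof. vring. Qed.

Lemma triple_two_terms (x1 y1 x2 y2 x3 y3 : A) u v w :
  triple (x1 *: v + y1 *: u) (x2 *: w + y2 *: u) (x3 *: w + y3 *: v) =
  (- (x1 * y2 * x3) - y1 * x2 * y3) * triple u v w.
Proof. vring. Qed.

(** Desargues' theorem as an identity: for points a_i and b_i of a projective
    plane, the cross products of the left-hand side are the intersections of
    corresponding sides of the two triangles, and the a_i x b_i are the lines
    joining corresponding vertices. *)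
Lemma desargues (a1 a2 a3 b1 b2 b3 : 'rV[A]_3) :
  triple (cross (cross a1 a2) (cross b1 b2))
         (cross (cross a1 a3) (cross b1 b3))
         (cross (cross a2 a3) (cross b2 b3))
  = triple a1 a2 a3 * triple b1 b2 b3 *
    - triple (cross a1 b1) (cross a2 b2) (cross a3 b3).
Proof.
(* This puts the three vectors on the left in the span of the a_i, so that
   triple a1 a2 a3 splits off and an identity of degree 9 remains. *)
have E (x y z w : 'rV[A]_3) : cross (cross x y) (cross z w) =
   triple x z w *: y + (- triple y z w) *: x by vring.
rewrite !{1}E triple_two_terms mulrC -!mulrA; congr (_ * _); vring.
Qed.
End VectorIdentities.

(** * Skewers in vector coordinates *)

Lemma mul_unit0 (A : comUnitRingType) (k x : A) :
  k \is a GRing.unit -> k * x = 0 -> x = 0.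
Proof. by move=> Uk /(congr1 ( *%R k^-1)); rewrite mulKr // mulr0. Qed.

Section SkewersInCoordinates.
Local Open Scope classical_set_scope.
Variables (R : realType) (X : geometry) (A : comUnitRingType).
Variable coord : set (space_point R X) -> 'rV[A]_3 -> Prop.
Implicit Types (a b l m s : set (space_point R X)) (u v w : 'rV[A]_3).

(** The dictionary between lines and vectors. A line has many vectors; that they
    are proportional is [lc_same] for a line and itself, and in elliptic space
    [lc_same] says that the vectors of the dual line are proportional to them
    too. *)
Record line_coordinates : Prop := LineCoordinates {
  lc_line : forall l, is_line l -> exists v, coord l v;
  lc_unit : forall l v, coord l v -> sprod v v \is a GRing.unit;
  lc_surj : forall v, sprod v v \is a GRing.unit ->
    exists2 l, is_line l & coord l v;
  lc_orth : forall l m v w, coord l v -> coord m w ->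
    (meets_at_right_angle l m <-> sprod v w = 0);
  lc_same : forall l m v w, coord l v -> coord m w ->
    same_skewer l m -> cross v w = 0 }.

(** The ring-theoretic input to [skewer_cross]. The condition with the square
    keeps a modified vector non-isotropic: adding z g to a vector w orthogonal
    to g changes w . w by z ^+ 2 (g . g). *)
Definition has_unit_preserving_annihilators := forall y d e : A,
  y \isn't a GRing.unit -> d \is a GRing.unit ->
  exists z, [/\ z != 0, z * y = 0 & d + z ^+ 2 * e \is a GRing.unit].

Hypotheses (lc : line_coordinates) (ann : has_unit_preserving_annihilators).

(** With w the vector of the unique skewer, u and v are both orthogonal to w, so
    u x v is a multiple k w. If k were not a unit, take z as in
    [has_unit_preserving_annihilators]: the vector w + z (w x u) is orthogonal
    to u, because w x u is, and to v, because (w x u) . v is a multiple of k. It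
    is thus another skewer, not proportional to w. *)
Lemma skewer_cross a b s u v w : is_S a b s ->
  coord a u -> coord b v -> coord s w ->
  exists2 k, k \is a GRing.unit & cross u v = k *: w.
Proof.
case=> -[ls sa sb] uniq au bv sw.
have wu : sprod w u = 0 by apply/(lc_orth lc sw au).
have wv : sprod w v = 0 by apply/(lc_orth lc sw bv).
have Uu := lc_unit lc au; have Uw := lc_unit lc sw.
pose k := triple w u v / sprod w w.
have uvE : cross u v = k *: w.
  rewrite /k mulrC -scalerA triple_expand wu wv !scale0r !addr0.
  by rewrite scalerA mulVr // scale1r.
exists k => //; apply/negPn/negP => nUk.
pose g := cross w u.
have wg : sprod w g = 0 by exact: sprod_crossl.
have [z [z0 zk Ut]] := ann (sprod g g) nUk Uw.
pose t := w + z *: g.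
have tt : sprod t t = sprod w w + z ^+ 2 * sprod g g.
  by rewrite !(sprodDl, sprodDr, sprodZl, sprodZr) (sprodC g) wg; ring.
have [l ll lt] := lc_surj lc (etrans (congr1 _ tt) Ut).
have tsk : is_skewer a b l.
  split=> //.
    apply/(lc_orth lc lt au).
    by rewrite sprodDl sprodZl wu sprodC sprod_crossr mulr0 addr0.
  apply/(lc_orth lc lt bv); rewrite sprodDl sprodZl wv add0r sprodC.
  by rewrite -/(triple v w u) tripleC /triple uvE sprodZr mulrA zk mul0r.
have := lc_same lc lt sw (uniq _ tsk).
rewrite crossDl crossvv add0r crossZl crossC bac_cab wu scale0r sub0r opprK.
move=> /(congr1 (fun x => sprod x u)).
rewrite scalerA sprodZl sprod0l.
move=> /(canRL (mulrK Uu)); rewrite mul0r => /(canRL (mulrK Uw)).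
by rewrite mul0r => /eqP; rewrite (negPf z0).
Qed.

Lemma triple_skewers s1 s2 s3 u v w : share_skewer s1 s2 s3 ->
  coord s1 u -> coord s2 v -> coord s3 w -> triple u v w = 0.
Proof.
case=> t [lt t1 t2 t3] c1 c2 c3; have [x tx] := lc_line lc lt.
have x1 := (lc_orth lc tx c1).1 t1; have x2 := (lc_orth lc tx c2).1 t2.
have x3 := (lc_orth lc tx c3).1 t3.
have := triple_expand u v w x; rewrite x1 x2 x3 !scale0r !addr0.
move=> /(congr1 (fun y => sprod y x)); rewrite sprodZl sprod0l.
by move=> /(canRL (mulrK (lc_unit lc tx))); rewrite mul0r.
Qed.

Lemma skewers_triple c1 c2 c3 u v w : has_unique_skewer c1 c2 ->
  coord c1 u -> coord c2 v -> coord c3 w -> triple u v w = 0 ->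
  share_skewer c1 c2 c3.
Proof.
case=> t tS c1u c2v c3w uvw; have [[lt t1 t2] _] := tS.
have [x tx] := lc_line lc lt.
have [k Uk uvE] := skewer_cross tS c1u c2v tx.
exists t; split=> //; apply/(lc_orth lc tx c3w).
move: uvw; rewrite -tripleC /triple uvE sprodC sprodZl mulrC.
by move=> /(canRL (mulrK Uk)); rewrite mul0r.
Qed.

Lemma skewer_cross_cross a a' b b' p q c u u' v v' w :
  is_S a a' p -> is_S b b' q -> is_S p q c ->
  coord a u -> coord a' u' -> coord b v -> coord b' v' -> coord c w ->
  exists2 k, k \is a GRing.unit & cross (cross u u') (cross v v') = k *: w.
Proof.
move=> Sp Sq Sc au au' bv bv' cw.
have [[/(lc_line lc)[x px] _ _] _] := Sp.
have [[/(lc_line lc)[y qy] _ _] _] := Sq.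
have [k Uk ->] := skewer_cross Sp au au' px.
have [k' Uk' ->] := skewer_cross Sq bv bv' qy.
have [k2 Uk2 xyE] := skewer_cross Sc px qy cw.
exists (k * (k' * k2)); first by rewrite !unitrM Uk Uk'.
by rewrite crossZl crossZr xyE !scalerA mulrA.
Qed.

Theorem skewer_desargues (a1 a2 a3 b1 b2 b3 s1 s2 s3
    p12 p13 p23 q12 q13 q23 c12 c13 c23 : set (space_point R X)) :
  [/\ is_line a1, is_line a2 & is_line a3] ->
  [/\ is_line b1, is_line b2 & is_line b3] ->
  [/\ is_S a1 b1 s1, is_S a2 b2 s2 & is_S a3 b3 s3] ->
  [/\ is_S a1 a2 p12, is_S a1 a3 p13 & is_S a2 a3 p23] ->
  [/\ is_S b1 b2 q12, is_S b1 b3 q13 & is_S b2 b3 q23] ->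
  [/\ is_S p12 q12 c12, is_S p13 q13 c13 & is_S p23 q23 c23] ->
  [\/ has_unique_skewer c12 c13, has_unique_skewer c12 c23
    | has_unique_skewer c13 c23] ->
  share_skewer s1 s2 s3 -> share_skewer c12 c13 c23.
Proof.
move=> [/(lc_line lc)[u1 U1] /(lc_line lc)[u2 U2] /(lc_line lc)[u3 U3]].
move=> [/(lc_line lc)[v1 V1] /(lc_line lc)[v2 V2] /(lc_line lc)[v3 V3]].
have coordS a b s : is_S a b s -> exists v, coord s v.
  by case=> -[/(lc_line lc)].
move=> [Ss1 Ss2 Ss3] [Sp1 Sp2 Sp3] [Sq1 Sq2 Sq3] [Sc1 Sc2 Sc3] uniq share.
have [[w1 W1] [w2 W2] [w3 W3]] :=
  And3 (coordS _ _ _ Ss1) (coordS _ _ _ Ss2) (coordS _ _ _ Ss3).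
have [[x1 X1] [x2 X2] [x3 X3]] :=
  And3 (coordS _ _ _ Sc1) (coordS _ _ _ Sc2) (coordS _ _ _ Sc3).
have [k1 _ E1] := skewer_cross Ss1 U1 V1 W1.
have [k2 _ E2] := skewer_cross Ss2 U2 V2 W2.
have [k3 _ E3] := skewer_cross Ss3 U3 V3 W3.
have [l1 L1 F1] := skewer_cross_cross Sp1 Sq1 Sc1 U1 U2 V1 V2 X1.
have [l2 L2 F2] := skewer_cross_cross Sp2 Sq2 Sc2 U1 U3 V1 V3 X2.
have [l3 L3 F3] := skewer_cross_cross Sp3 Sq3 Sc3 U2 U3 V2 V3 X3.
have x0 : triple x1 x2 x3 = 0.
  have := desargues u1 u2 u3 v1 v2 v3.
  rewrite E1 E2 E3 F1 F2 F3 !tripleZ (triple_skewers share W1 W2 W3).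
  rewrite mulr0 oppr0 mulr0.
  by apply: mul_unit0; rewrite !unitrM L1 L2.
have x0' : triple x1 x3 x2 = 0.
  by rewrite /triple crossC -scaleN1r sprodZr -/(triple _ _ _) x0 mulr0.
case: uniq => uniq.
- exact: skewers_triple uniq X1 X2 X3 x0.
- have [t [lt t1 t3 t2]] := skewers_triple uniq X1 X3 X2 x0'.
  by exists t; split.
- have := skewers_triple uniq X2 X3 X1 _; rewrite -tripleC.
  by move=> /(_ x0) [t [lt t2 t3 t1]]; exists t; split.
Qed.
End SkewersInCoordinates.

(** * Generalized complex numbers *)

(** The ring R[j] with j ^ 2 = s, in which [gc s a b] stands for a + j b. *)
Definition gcomplex (R : realType) (s : R) : Type := (R * R)%type.
Definition gc (R : realType) (s a b : R) : gcomplex s := (a, b).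

Section GeneralizedComplex.
Variables (R : realType) (s : R).
Local Notation A := (gcomplex s).
Implicit Types x y z : A.

HB.instance Definition _ := GRing.Zmodule.copy A (R * R)%type.

Definition gcmul x y : A := gc s (x.1 * y.1 + s * x.2 * y.2) (x.1 * y.2 + x.2 * y.1).

Fact gcmulA : associative gcmul.
Proof. by move=> [a b] [c d] [e f]; congr pair; rewrite /=; ring. Qed.
Fact gcmulC : commutative gcmul.
Proof. by move=> [a b] [c d]; congr pair; rewrite /=; ring. Qed.
Fact gcmul1 : left_id (gc s 1 0) gcmul.
Proof. by move=> [a b]; congr pair; rewrite /=; ring. Qed.
Fact gcmulD : left_distributive gcmul +%R.
Proof. by move=> [a b] [c d] [e f]; congr pair; rewrite /=; ring. Qed.
Fact gc1_neq0 : gc s 1 0 != 0.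
Proof. by apply/eqP => -[] /eqP; rewrite oner_eq0. Qed.
HB.instance Definition _ := GRing.Zmodule_isComNzRing.Build A
  gcmulA gcmulC gcmul1 gcmulD gc1_neq0.

(** The product of x with its conjugate. *)
Definition gnorm x : R := x.1 ^+ 2 - s * x.2 ^+ 2.
Definition gcinv x : A :=
  if gnorm x == 0 then x else gc s (x.1 / gnorm x) (- x.2 / gnorm x).

Lemma gnormM x y : gnorm (x * y) = gnorm x * gnorm y.
Proof. by rewrite /gnorm /=; ring. Qed.

Fact gcmulV : {in [pred x | gnorm x != 0], left_inverse 1 gcinv *%R}.
Proof.
move=> x; rewrite inE => Nx; rewrite /gcinv (negPf Nx); congr pair => /=.
  by rewrite mulrAC -mulrA mulrAC; rewrite /gnorm in Nx *; field.
by rewrite /gnorm in Nx *; field.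
Qed.
Fact gcunitP x y : y * x = 1 -> gnorm x != 0.
Proof.
move=> /(congr1 gnorm); rewrite gnormM => yx; apply/eqP => x0; move: yx.
rewrite x0 mulr0 /gnorm /= => /eqP.
by rewrite expr1n expr0n /= mulr0 subr0 eq_sym oner_eq0.
Qed.
Fact gcinv_out : {in [predC [pred x | gnorm x != 0]], gcinv =1 id}.
Proof. by move=> x; rewrite !inE negbK /gcinv => ->. Qed.
HB.instance Definition _ := GRing.ComNzRing_hasMulInverse.Build A
  gcmulV gcunitP gcinv_out.

Lemma gcunitE x : (x \is a GRing.unit) = (gnorm x != 0).
Proof. by []. Qed.

Lemma gcM a b c d : gc s a b * gc s c d = gc s (a * c + s * b * d) (a * d + b * c).
Proof. by []. Qed.
Lemma gcD a b c d : gc s a b + gc s c d = gc s (a + c) (b + d).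
Proof. by []. Qed.
Lemma gcN a b : - gc s a b = gc s (- a) (- b).
Proof. by []. Qed.
Lemma gnormE a b : gnorm (gc s a b) = a ^+ 2 - s * b ^+ 2.
Proof. by []. Qed.
Lemma gcE x : x = gc s x.1 x.2.
Proof. by case: x. Qed.
Lemma gc_inj a b c d : gc s a b = gc s c d -> a = c /\ b = d.
Proof. by case. Qed.

(** A nonunit y is killed by its conjugate (by 1 if y = 0), hence by all the
    multiples t conj y with t real. The norm of d + t ^+ 2 f is a polynomial of
    degree at most 2 in t ^+ 2 with nonzero constant term. *)
Lemma gc_annihilators : has_unit_preserving_annihilators A.
Proof.
move=> y d e; rewrite !gcunitE negbK => /eqP Ny Nd.
have [z z0 zy] : exists2 z : A, z != 0 & z * y = 0.
  have [-> | y0] := eqVneq y 0; first by exists 1; rewrite ?oner_eq0 ?mulr0.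
  case: y Ny y0 => a b; rewrite /gnorm /= => Ny y0.
  exists (gc s a (- b)).
    apply: contra_neq y0 => -[-> /eqP]; rewrite oppr_eq0 => /eqP ->; exact: erefl.
  by congr pair => /=; [rewrite -Ny; ring | ring].
pose N t := gnorm (d + gc s t 0 * (z ^+ 2 * e)).
suff [t t0 Nt] : exists2 t, t != 0 & N (t ^+ 2) != 0.
  exists (gc s t 0 * z); split.
  - apply: contra_neq z0 => /(congr1 (fun w => gc s t^-1 0 * w)).
    rewrite mulr0 mulrA gcM mulVf // !mulr0 mul0r !addr0 => <-.
    exact: esym (mul1r _).
  - by rewrite -mulrA zy mulr0.
  - rewrite gcunitE; move: Nt; rewrite /N.
    have -> : gc s (t ^+ 2) 0 = gc s t 0 ^+ 2 by congr pair => /=; ring.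
    by rewrite exprMn mulrA.
have [b [c NE]] : exists b c, forall t, N t = gnorm d + t * b + t ^+ 2 * c.
  rewrite /N; case: d {Nd N} (z ^+ 2 * e) => d1 d2 [f1 f2].
  exists (2 * (d1 * f1 - s * d2 * f2)), (gnorm (gc s f1 f2)) => t.
  by rewrite -!/(gc s _ _) gcM gcD !gnormE; ring.
(* A polynomial of degree at most 2 vanishing at 1, 4 and 9 is zero. *)
have [N1|] := eqVneq (N (1 ^+ 2)) 0; last by exists 1; rewrite ?oner_eq0.
have [N2|] := eqVneq (N (2 ^+ 2)) 0; last by exists 2; rewrite ?pnatr_eq0.
have [N3|] := eqVneq (N (3 ^+ 2)) 0; last by exists 3; rewrite ?pnatr_eq0.
case/eqP: Nd; move: N1 N2 N3; rewrite !NE; lra.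
Qed.

(** The vector a + j b; [gre] and [gim] recover its two parts. *)
Definition gvec (a b : 'rV[R]_3) : 'rV[A]_3 := \row_i gc s (a 0 i) (b 0 i).
Definition gre (v : 'rV[A]_3) : 'rV[R]_3 := \row_i (v 0 i).1.
Definition gim (v : 'rV[A]_3) : 'rV[R]_3 := \row_i (v 0 i).2.

Lemma gvecE v : v = gvec (gre v) (gim v).
Proof. by apply/rowP => i; rewrite !mxE; case: (v 0 i). Qed.

Lemma sprod_gvec a b c d : sprod (gvec a b) (gvec c d) =
  gc s (sprod a c + s * sprod b d) (sprod a d + sprod b c).
Proof. rewrite !sprodE !mxE !(gcM, gcD); congr gc => /=; ring. Qed.

Lemma cross_gvec a b c d : cross (gvec a b) (gvec c d) =
  gvec (cross a c + s *: cross b d) (cross a d + cross b c).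
Proof.
by apply: row3_ext; rewrite /cross !(row3E, mxE) !(gcM, gcN, gcD);
  congr gc => /=; ring.
Qed.

Lemma gvecD a b c d : gvec a b + gvec c d = gvec (a + c) (b + d).
Proof. by apply/rowP => i; rewrite !mxE. Qed.

Lemma scale_gvec (x y : R) a b :
  gc s x y *: gvec a b = gvec (x *: a + (s * y) *: b) (x *: b + y *: a).
Proof. by apply/rowP => i; rewrite !mxE. Qed.

End GeneralizedComplex.

(** * Normalization of vectors *)

Section RealVectors.
Variable R : realType.
Implicit Types u v : 'rV[R]_3.
Lemma sprod_ge0 u : 0 <= sprod u u.
Proof. by rewrite sprodE !addr_ge0 // -expr2 sqr_ge0. Qed.
Lemma sprod_eq0 u : (sprod u u == 0) = (u == 0).
Proof.
apply/eqP/eqP => [|->]; last exact: sprod0l.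
rewrite sprodE => u0; apply: row3_ext; rewrite mxE; nra.
Qed.
Lemma sprod_gt0 u : (0 < sprod u u) = (u != 0).
Proof. by rewrite lt_neqAle sprod_ge0 andbT eq_sym sprod_eq0. Qed.
End RealVectors.

Section Normalization.
Variables (R : realType) (s : R).
Hypothesis s_cases : [\/ s = -1, s = 0 | s = 1].
Local Notation A := (gcomplex s).

(** For s = 1 the norm of v . v is the product of the squared lengths of a + b
    and a - b, where v = a + j b. *)
Lemma gnorm_sprod_gt0 (v : 'rV[A]_3) : sprod v v \is a GRing.unit ->
  0 < gnorm (sprod v v) /\ (s = -1 \/ 0 <= (sprod v v).1).
Proof.
rewrite gcunitE (gvecE v) sprod_gvec gnormE.
move: (gre v) (gim v) => a b.
rewrite [sprod b a]sprodC => N0.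
have [ha hb] := (sprod_ge0 a, sprod_ge0 b).
split; last by case: s_cases => ->; [left | right; rewrite mul0r addr0
                                   | right; rewrite mul1r addr_ge0].
rewrite lt_neqAle eq_sym N0 /=; case: s_cases => -> /=.
- by rewrite -mulNr opprK mul1r addr_ge0 ?sqr_ge0.
- by rewrite !mul0r subr0 sqr_ge0.
have := mulr_ge0 (sprod_ge0 (a + b)) (sprod_ge0 (a - b)).
rewrite -scaleN1r !(sprodDl, sprodDr, sprodZl, sprodZr) [sprod b a]sprodC.
by congr (0 <= _); ring.
Qed.

(** With t the square root of the norm of n, one has (n + t) ^+ 2 = 2 (a + t) n
    for n = a + j b, because n is a root of X ^+ 2 - 2 a X + t ^+ 2. So the
    conjugate of n + t can serve as k. It is not a unit when a + t <= 0, that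
    is, when n is a negative real and s = -1; then k = j works. *)
Lemma unit_times_square_pos (n : A) :
  0 < gnorm n -> s = -1 \/ 0 <= n.1 ->
  exists k (r : R), [/\ k \is a GRing.unit, 0 < r & k ^+ 2 * n = gc s r 0].
Proof.
case: n => a b Nn n0.
set N := gnorm _ in Nn.
have [t0 tN] : 0 < Num.sqrt N /\ Num.sqrt N ^+ 2 = N.
  by rewrite sqrtr_gt0 sqr_sqrtr // ltW.
move: (Num.sqrt N) t0 tN => t t0; rewrite /N /gnorm /= => tN.
have [at0 | at0] := ltrP 0 (a + t).
  exists (gc s (a + t) (- b)), (2 * (a + t) * t ^+ 2); split.
  - rewrite gcunitE gnormE; apply: lt0r_neq0.
    suff -> : (a + t) ^+ 2 - s * (- b) ^+ 2 = 2 * t * (a + t) by rewrite !mulr_gt0.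
    by rewrite sqrrN; ring: tN.
  - by rewrite !mulr_gt0 // exprn_gt0.
  - by congr pair => /=; ring: tN.
case: n0 => [s1 | /= a0]; last by lra.
have b0 : b = 0 by move: tN; rewrite s1; nra.
exists (gc s 0 1), (- a); split; rewrite ?gcunitE ?gnormE ?s1.
- by rewrite expr0n expr1n /= mulr1 opprK add0r oner_eq0.
- lra.
- by rewrite b0; congr pair => /=; rewrite ?s1; ring.
Qed.

(** The vectors of actual lines: a direction a and a moment b are orthogonal and
    a is nonzero. For s = 1 the normalized vector may have a = 0; multiplying by
    j exchanges a and b. *)
Lemma gvec_normalize (v : 'rV[A]_3) : sprod v v \is a GRing.unit ->
  exists k a b, [/\ k \is a GRing.unit, v = k *: gvec s a b, a != 0,
    sprod a b = 0 & 0 < sprod a a + s * sprod b b].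
Proof.
move=> Uv; have [N0 n0] := gnorm_sprod_gt0 Uv.
have [k [r [Uk r0 kr]]] := unit_times_square_pos N0 n0.
pose a := gre (k *: v); pose b := gim (k *: v).
have vE : v = k^-1 *: gvec s a b by rewrite -gvecE scalerA mulVr // scale1r.
have [aa ab] : sprod a a + s * sprod b b = r /\ sprod a b = 0.
  have : sprod (k *: v) (k *: v) = gc s r 0.
    by rewrite sprodZl sprodZr mulrA -expr2.
  rewrite [k *: v]gvecE sprod_gvec => /gc_inj[-> ]; rewrite [sprod b a]sprodC.
  by rewrite -/a -/b; split=> //; lra.
have [a0 | a0] := eqVneq a 0; last first.
  by exists k^-1, a, b; split=> //; rewrite ?unitrV ?aa.
have s1 : s = 1.
  case: s_cases aa => // ->; rewrite a0 sprod0l; have := sprod_ge0 b; lra.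
exists (k^-1 * gc s 0 1), b, a; split.
- by rewrite unitrM unitrV Uk gcunitE gnormE s1; apply/eqP; lra.
- by rewrite -scalerA scale_gvec mulr1 [in X in X *: a]s1 !scale0r !add0r !scale1r.
- by apply/eqP => b0; move: aa; rewrite b0 a0 sprod0l; lra.
- by rewrite sprodC.
- by rewrite s1 mul1r addrC -[sprod b b]mul1r -s1 aa.
Qed.
End Normalization.

(** * Euclidean lines *)

Section EuclideanCoordinates.
Variable R : realType.
Local Notation A := (gcomplex (0 : R)).
Implicit Types (p u x : 'rV[R]_3) (l m : set 'rV[R]_3).

Definition euclidean_plucker p u : 'rV[A]_3 := gvec 0 u (cross p u).

Definition euclidean_coord l (v : 'rV[A]_3) :=
  exists (k : A) p u, [/\ k \is a GRing.unit, u != 0, l = euclidean_line_at p u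
    & v = k *: euclidean_plucker p u].

Lemma euclidean_line_at_inj p u p' u' :
  euclidean_line_at p u = euclidean_line_at p' u' ->
  exists c, euclidean_plucker p' u' = gc 0 c 0 *: euclidean_plucker p u.
Proof.
move=> e.
have [t _ tE] : euclidean_line_at p u p' by rewrite e; exists 0; rewrite ?scale0r ?addr0.
have [r _ rE] : euclidean_line_at p u (p' + u') by rewrite e; exists 1; rewrite ?scale1r.
have uE : u' = (r - t) *: u.
  by rewrite -[u'](addKr p') -rE -tE opprD addrACA addNr add0r scalerBl addrC.
exists (r - t); rewrite scale_gvec mul0r !scale0r !addr0 /euclidean_plucker uE -tE.
by rewrite crossZr crossDl crossZl crossvv scaler0 addr0.
Qed.

Lemma euclidean_line_at_shift p u t :
  euclidean_line_at (p + t *: u) u = euclidean_line_at p u.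
Proof.
apply/seteqP; split=> x [r _ <-].
  by exists (t + r) => //; rewrite scalerDl addrA.
by exists (r - t) => //; rewrite -addrA -scalerDl [t + _]addrC subrK.
Qed.

Lemma sprod_euclidean_plucker p u p' u' :
  sprod (euclidean_plucker p u) (euclidean_plucker p' u') =
  gc 0 (sprod u u') (triple (p - p') u u').
Proof.
rewrite sprod_gvec mul0r addr0; congr gc.
by rewrite /triple !sprodE /cross !(row3E, mxE); ring.
Qed.

(** When the directions u and u' are orthogonal, the dual part of the product
    vanishes exactly when p' - p lies in the plane of u and u'; its components
    along u and u' then lead from p and from p' to the intersection. *)
Lemma euclidean_orth l m (v w : 'rV[A]_3) :
  euclidean_coord l v -> euclidean_coord m w ->
  euclidean_right_angle l m <-> sprod v w = 0.
Proof.
move=> [k [p [u [Uk u0 -> ->]]]] [k' [p' [u' [Uk' u0' -> ->]]]].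
have -> : sprod (k *: euclidean_plucker p u) (k' *: euclidean_plucker p' u') = 0 <->
    sprod (euclidean_plucker p u) (euclidean_plucker p' u') = 0.
  rewrite sprodZl sprodZr; split=> [/(mul_unit0 Uk)/(mul_unit0 Uk') // | ->].
  by rewrite !mulr0.
split=> [[x [w1 [w2 [_ _ w12 /esym/euclidean_line_at_inj[c ->]]]]]|].
  move=> /esym/euclidean_line_at_inj[c' ->].
  rewrite sprodZl sprodZr sprod_euclidean_plucker subrr.
  by rewrite [sprod w1 w2]w12 /triple sprod0l (_ : gc 0 0 0 = 0) ?mulr0.
rewrite sprod_euclidean_plucker => /gc_inj[uu' ppu].
have [n0 n0'] : sprod u u != 0 /\ sprod u' u' != 0 by rewrite !sprod_eq0.
have [r rdef] : exists r, r = p' - p by exists (p' - p).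
have rn : sprod r (cross u u') = 0.
  by rewrite rdef -[p' - p]opprB -scaleN1r sprodZl -/(triple _ _ _) ppu mulr0.
pose a := sprod r u / sprod u u; pose b := sprod r u' / sprod u' u'.
have rE : r = a *: u + b *: u'.
  (* p' - p minus its projections on u and u' is orthogonal to the basis
     u, u', u x u'. *)
  have nn : triple u u' (cross u u') = sprod u u * sprod u' u'.
    by rewrite tripleC tripleC /triple lagrange uu' expr0n subr0.
  pose d := r - a *: u - b *: u'.
  have /eqP : triple u u' (cross u u') *: d = 0.
    rewrite triple_expand !(sprodDl, sprodZl, =^~ scaleN1r) [sprod u' u]sprodC uu'.
    rewrite !sprod_crossl !sprod_crossr rn.
    rewrite /a /b !mulr0 !addr0 !divfK // !mulN1r !subrr.
    by rewrite !scale0r !addr0.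
  rewrite nn scaler_eq0 mulf_eq0 (negPf n0) (negPf n0') /= subr_eq0 subr_eq addrC.
  by move=> /eqP.
exists (p + a *: u), u, u'; split=> //; first by rewrite euclidean_line_at_shift.
rewrite -[RHS](euclidean_line_at_shift _ _ b) -addrA -rE rdef.
by rewrite addrC subrK.
Qed.

Lemma euclidean_coordinates :
  @line_coordinates R Euclidean A euclidean_coord.
Proof.
split.
- move=> l [p [u [u0 ->]]]; exists (euclidean_plucker p u), 1, p, u.
  by rewrite scale1r unitr1.
- move=> l v [k [p [u [Uk u0 _ ->]]]].
  rewrite sprodZl sprodZr sprod_gvec !unitrM Uk gcunitE gnormE !mul0r addr0 subr0.
  by rewrite sqrf_eq0 sprod_eq0.
- move=> v /gvec_normalize[| k [a [b [Uk -> a0 ab _]]]]; first exact: Or32.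
  have n0 : sprod a a != 0 by rewrite sprod_eq0.
  (* The point of the line closest to the origin. *)
  pose p := (sprod a a)^-1 *: cross a b.
  exists (euclidean_line_at p a); first by exists p, a.
  exists k, p, a; split=> //; congr (k *: gvec 0 a _).
  by rewrite crossZl crossC bac_cab ab scale0r sub0r opprK scalerA mulVf ?scale1r.
- exact: euclidean_orth.
- move=> l m v w [k [p [u [_ _ -> ->]]]] [k' [p' [u' [_ _ -> ->]]]].
  move=> /euclidean_line_at_inj[c ->].
  by rewrite !crossZl !crossZr crossvv !scaler0.
Qed.
End EuclideanCoordinates.

(** * Pluecker coordinates of planes in dimension four *)

(** Matrices given by functions on natural numbers keep the indices of iterated
    minors computable. *)
Definition natmx {R : comNzRingType} n (f : nat -> nat -> R) :=
  \matrix_(i < n, j < n) f i j.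
Definition natminor {R : comNzRingType} (f : nat -> nat -> R) l i k :=
  f i.+1 (bump l k).
Lemma det_natmx (R : comNzRingType) n (f : nat -> nat -> R) :
  \det (natmx n.+1 f) =
  \sum_(j < n.+1) f 0%N j * ((-1) ^+ j * \det (natmx n (natminor f j))).
Proof.
rewrite (expand_det_row _ ord0); apply: eq_bigr => j _.
rewrite mxE /cofactor add0n; congr (_ * (_ * \det _)).
by apply/matrixP => i k; rewrite !mxE.
Qed.

Lemma det4 (R : comNzRingType) (f : nat -> nat -> R) :
  \det (\matrix_(i < 4, j < 4) f i j) =
  let g i j := f 0%N i * f 1%N j - f 0%N j * f 1%N i in
  let h i j := f 2%N i * f 3%N j - f 2%N j * f 3%N i in
  g 0%N 1%N * h 2%N 3%N - g 0%N 2%N * h 1%N 3%N + g 0%N 3%N * h 1%N 2%N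
  + g 1%N 2%N * h 0%N 3%N - g 1%N 3%N * h 0%N 2%N + g 2%N 3%N * h 0%N 1%N.
Proof.
rewrite -/(natmx 4 f) !(det_natmx, big_ord_recl, big_ord0, det_mx00).
by rewrite /natminor /bump /=; ring.
Qed.

Section Quadric.
Variables (R : realType) (s : R).
Local Notation A := (gcomplex s).
Implicit Types x y z w p u : 'rV[R]_4.

Definition spatial x : 'rV[R]_3 := \row_i x 0 (lift ord0 i).

Lemma spatialD x y : spatial (x + y) = spatial x + spatial y.
Proof. by apply/rowP => i; rewrite !mxE. Qed.
Lemma spatialZ a x : spatial (a *: x) = a *: spatial x.
Proof. by apply/rowP => i; rewrite !mxE. Qed.

Lemma eq_row4 x y : x 0 0 = y 0 0 -> spatial x = spatial y -> x = y.
Proof.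
move=> e0 /rowP e; apply/rowP => i; case: (unliftP ord0 i) => [j|] -> //.
by have := e j; rewrite !mxE.
Qed.

(** The Lorentz form for s = -1 and the Euclidean one for s = 1. *)
Definition qform x y : R := s * (x 0 0 * y 0 0) + sprod (spatial x) (spatial y).

(** The coordinates of the bivector x /\ y. *)
Definition plucker x y : 'rV[A]_3 :=
  gvec s (x 0 0 *: spatial y - y 0 0 *: spatial x)
         (cross (spatial x) (spatial y)).

Lemma qformC x y : qform x y = qform y x.
Proof. by rewrite /qform sprodC [x 0 0 * _]mulrC. Qed.
Lemma qformDl x y z : qform (x + y) z = qform x z + qform y z.
Proof. by rewrite /qform spatialD sprodDl mxE; ring. Qed.
Lemma qformZl a x z : qform (a *: x) z = a * qform x z.
Proof. by rewrite /qform spatialZ sprodZl mxE; ring. Qed.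
Lemma qformDr x y z : qform z (x + y) = qform z x + qform z y.
Proof. by rewrite !(qformC z) qformDl. Qed.
Lemma qformZr a x z : qform z (a *: x) = a * qform z x.
Proof. by rewrite !(qformC z) qformZl. Qed.
Lemma qform0l x : qform 0 x = 0.
Proof. by rewrite -(scale0r x) qformZl mul0r. Qed.

Ltac vcoord := rewrite /triple ?(spatialD, spatialZ) /cross ?sprodE ?(row3E, mxE).

Lemma plucker_comb p u (a b c d : R) :
  plucker (a *: p + b *: u) (c *: p + d *: u) =
  gc s (a * d - b * c) 0 *: plucker p u.
Proof.
rewrite scale_gvec mulr0 !scale0r !addr0; congr gvec.
  by apply: row3_ext; vcoord; ring.
by apply: row3_ext; vcoord; ring.
Qed.

(** The form [qform] is nondegenerate exactly when s is nonzero; s * s = 1 lets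
    it be identified with its dual form. *)
Hypothesis ss : s * s = 1.

(** Up to s, the form induced on bivectors. *)
Lemma sprod_plucker_re x y z w : (sprod (plucker x y) (plucker z w)).1 =
  s * (qform x z * qform y w - qform x w * qform y z).
Proof. by rewrite sprod_gvec /qform /=; vcoord; ring: ss. Qed.

(** The wedge of the two bivectors: it vanishes when the planes meet. *)
Lemma sprod_plucker_im x y z w : (sprod (plucker x y) (plucker z w)).2 =
  \det (\matrix_(i < 4) nth 0 [:: x; y; z; w] i).
Proof.
have -> : \matrix_(i < 4) nth 0 [:: x; y; z; w] i =
    \matrix_(i < 4, j < 4) nth 0 [:: x; y; z; w] i 0 (inord j).
  by apply/matrixP => i j; rewrite !mxE inord_val.
rewrite (det4 (fun i j => nth 0 [:: x; y; z; w] i 0 (inord j))) /=.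
rewrite sprod_gvec /=; vcoord.
have -> : inord 0 = 0 :> 'I_4 by apply: val_inj; rewrite /= inordK.
have -> : inord 1 = lift ord0 0 :> 'I_4 by apply: val_inj; rewrite /= inordK.
have -> : inord 2 = lift ord0 1 :> 'I_4 by apply: val_inj; rewrite /= inordK.
have -> : inord 3 = lift ord0 2%:R :> 'I_4 by apply: val_inj; rewrite /= inordK.
ring.
Qed.

(** Bivectors form the Lie algebra of the orthogonal group of [qform], and the
    cross product is its bracket: only terms containing a product of a vector
    of the first plane with one of the second occur. *)
Lemma cross_plucker x y z w : cross (plucker x y) (plucker z w) =
  gc s 0 (-1) *:
    (gc s (qform y z) 0 *: plucker x w + gc s (- qform y w) 0 *: plucker x z
   + gc s (- qform x z) 0 *: plucker y w + gc s (qform x w) 0 *: plucker y z).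
Proof.
rewrite /plucker cross_gvec !scale_gvec !gvecD scale_gvec /qform.
move: (x 0 0) (spatial x) (y 0 0) (spatial y) => x0 {}x y0 {}y.
move: (z 0 0) (spatial z) (w 0 0) (spatial w) => z0 {}z w0 {}w.
congr gvec.
  apply: row3_ext; rewrite !sprodE /cross !(row3E, mxE); ring: ss.
apply: row3_ext; rewrite !sprodE /cross !(row3E, mxE); ring: ss.
Qed.

Lemma cross_plucker_orth x y z w : qform x z = 0 -> qform x w = 0 ->
  qform y z = 0 -> qform y w = 0 -> cross (plucker x y) (plucker z w) = 0.
Proof.
move=> xz xw yz yw; rewrite cross_plucker xz xw yz yw !oppr0.
by rewrite (_ : gc s 0 0 = 0) // !scale0r !addr0 scaler0.
Qed.
Lemma sprod_plucker_common x y z : sprod (plucker x y) (plucker x z) =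
  gc s (s * (qform x x * qform y z - qform x z * qform y x)) 0.
Proof.
rewrite [LHS]gcE sprod_plucker_re; congr gc; rewrite sprod_gvec /=.
move: (x 0 0) (spatial x) (y 0 0) (spatial y) => x0 {}x y0 {}y.
by move: (z 0 0) (spatial z) => z0 {}z; vcoord; ring.
Qed.

Definition row4 t (a : 'rV[R]_3) : 'rV[R]_4 :=
  \row_i nth 0 [:: t; a 0 0; a 0 1; a 0 2%:R] i.

Lemma row4_0 t a : row4 t a 0 0 = t.
Proof. by rewrite mxE. Qed.
Lemma spatial_row4 t a : spatial (row4 t a) = a.
Proof. by apply: row3_ext; rewrite !mxE. Qed.
End Quadric.

Section Span.
Variables (R : realType) (n : nat).
Implicit Types p u x w : 'rV[R]_n.

Lemma mem_span2 p u x :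
  reflect (exists a b, x = a *: p + b *: u) (x \in <<[:: p; u]>>%VS).
Proof.
rewrite span_cons span_seq1; apply: (iffP memv_addP).
  by case=> _ /vlineP[a ->] [_ /vlineP[b ->] ->]; exists a, b.
by case=> a [b ->]; exists (a *: p); rewrite ?rpredZ ?memv_line //;
  exists (b *: u); rewrite ?rpredZ ?memv_line.
Qed.

Lemma span2_comb p u x w (a b c d : R) :
  x = a *: p + b *: u -> w = c *: p + d *: u -> a * d - b * c != 0 ->
  <<[:: x; w]>>%VS = <<[:: p; u]>>%VS.
Proof.
move=> xE wE D0; apply/eqP; rewrite eqEsubv; apply/andP; split.
  apply/span_subvP => y; rewrite !inE => /orP[] /eqP ->; apply/mem_span2.
    by exists a, b.
  by exists c, d.
have sol y1 y2 y3 y4 : forall e f : R, y1 * a + y2 * c = e -> y1 * b + y2 * d = f ->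
   y3 = e *: p + f *: u -> y4 = y1 *: x + y2 *: w -> y3 = y4 :> 'rV[R]_n.
  move=> e f <- <- -> ->; rewrite xE wE.
  by apply/rowP => i; rewrite !mxE; ring.
apply/span_subvP => y; rewrite !inE => /orP[] /eqP ->; apply/mem_span2.
  exists (d / (a * d - b * c)), (- b / (a * d - b * c)).
  apply: (sol _ _ _ _ 1 0 _ _ _ erefl); last by rewrite scale1r scale0r addr0.
    by field.
  by field.
exists (- c / (a * d - b * c)), (a / (a * d - b * c)).
apply: (sol _ _ _ _ 0 1 _ _ _ erefl); last by rewrite scale1r scale0r add0r.
  by field.
by field.
Qed.
End Span.

Section PositiveForm.
Variable R : realType.
Implicit Types u : 'rV[R]_4.

Lemma spatial0 u : u != 0 -> spatial u = 0 -> u 0 0 != 0.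
Proof.
move=> u0 su; apply: contra_neq u0 => u00.
by apply: eq_row4; rewrite ?mxE // su; apply/rowP => i; rewrite !mxE.
Qed.

Lemma qform1_gt0 u : u != 0 -> 0 < qform 1 u u.
Proof.
rewrite /qform mul1r -expr2 => u0; have [su|] := eqVneq (spatial u) 0.
  by rewrite su sprod0l addr0 lt_neqAle sqr_ge0 eq_sym sqrf_eq0 spatial0.
by rewrite -sprod_gt0; have := sqr_ge0 (u 0 0); lra.
Qed.
End PositiveForm.

(** * Planes with an orthogonal frame *)

Section Frames.
Variables (R : realType) (s : R).
Hypothesis s_pm : s = -1 \/ s = 1.
Implicit Types x y z w p u : 'rV[R]_4.
Local Notation q := (qform s).
Local Notation P := (@plucker R s).

Let ss : s * s = 1.
Proof. by case: s_pm => ->; rewrite ?mulrNN mulr1. Qed.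

(** A line of hyperbolic or elliptic space is given by a point p and a tangent
    vector u at p. *)
Definition frame p u := [/\ q p p = s, q p u = 0 & u != 0].

(** For s = -1: a vector orthogonal to a timelike one is spacelike, by the
    Cauchy-Schwarz inequality for the spatial parts. *)
Lemma qform_orth_gt0 p u : 0 < s * q p p -> q p u = 0 -> u != 0 -> 0 < q u u.
Proof.
rewrite /qform => pp pu u0.
case: s_pm pp pu => -> pp pu; last by have := qform1_gt0 u0; rewrite /qform.
have cs := sprod_ge0 (cross (spatial p) (spatial u)).
rewrite lagrange in cs.
have [su|] := eqVneq (spatial u) 0.
  move: pu (spatial0 u0 su); rewrite su sprodC !sprod0l addr0 mulN1r => /eqP.
  rewrite oppr_eq0 mulf_eq0 => /orP[/eqP p0|/eqP -> /eqP//].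
  by move: pp; rewrite p0; have := sprod_ge0 (spatial p); lra.
rewrite -sprod_gt0 => uu.
have pu' : sprod (spatial p) (spatial u) = p 0 0 * u 0 0 by lra.
rewrite pu' in cs; have := sprod_ge0 (spatial p); nra.
Qed.

Lemma frame_gt0 p u : frame p u -> 0 < q u u.
Proof. by case=> pp pu; apply: qform_orth_gt0 pu; rewrite pp ss. Qed.

Lemma frame_free p u (a b : R) : frame p u -> a *: p + b *: u = 0 -> a = 0 /\ b = 0.
Proof.
move=> pf e; have [pp pu _] := pf; have uu := frame_gt0 pf.
split.
  have := congr1 (q p) e; rewrite qformDr !qformZr pp pu mulr0 addr0.
  rewrite [q p 0]qformC qform0l => /(congr1 ( *%R^~ s)); rewrite -mulrA ss mulr1.
  by rewrite mul0r.
have := congr1 (q u) e; rewrite qformDr !qformZr (qformC _ u) pu mulr0 add0r.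
rewrite [q u 0]qformC qform0l => /eqP; rewrite mulf_eq0 (gt_eqF uu) orbF.
by move=> /eqP.
Qed.

Lemma frame_norm_comb p u x (a b : R) : frame p u -> x = a *: p + b *: u ->
  q x x = s * a ^+ 2 + q u u * b ^+ 2.
Proof.
move=> [pp pu u0] ->; rewrite !(qformDl, qformDr, qformZl, qformZr).
by rewrite pp pu (qformC s u p) pu; ring.
Qed.

(** Any non-isotropic x of the plane can replace p. *)
Lemma frame_rotate p u x (a b : R) : frame p u -> x = a *: p + b *: u ->
  q x x != 0 -> exists w,
  [/\ <<[:: p; u]>>%VS = <<[:: x; w]>>%VS, q x w = 0,
      q w w = s * q u u * q x x & P x w = gc s (q x x) 0 *: P p u].
Proof.
move=> pf xE x0; have [pp pu _] := pf; have up := etrans (qformC s u p) pu.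
have xx := frame_norm_comb pf xE.
exists ((- b * q u u) *: p + (a * s) *: u).
have D : a * (a * s) - b * (- b * q u u) = q x x by rewrite xx; ring.
split.
- by apply: esym; apply: (span2_comb xE erefl); rewrite D.
- by rewrite xE !(qformDl, qformDr, qformZl, qformZr) pp pu up; ring.
- rewrite xx !(qformDl, qformDr, qformZl, qformZr) pp pu up; ring: ss.
- by rewrite {1}xE plucker_comb D.
Qed.

Lemma frame_common p u p' u' : frame p u -> frame p' u' ->
  (sprod (P p u) (P p' u')).2 = 0 ->
  exists x a b c d, [/\ x != 0, x = a *: p + b *: u & x = c *: p' + d *: u'].
Proof.
move=> pf pf'; rewrite sprod_plucker_im => /eqP/det0P[c c0].
pose i1 : 'I_4 := lift ord0 ord0; pose i2 : 'I_4 := lift ord0 (lift ord0 ord0).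
pose i3 : 'I_4 := lift ord0 (lift ord0 (lift ord0 ord0)).
rewrite mulmx_sum_row !big_ord_recl big_ord0 !rowK /= addr0 -/i1 -/i2 -/i3 => e.
have xE : c 0 0 *: p + c 0 i1 *: u = - c 0 i2 *: p' + - c 0 i3 *: u'.
  by apply/eqP; rewrite -subr_eq0 !scaleNr -opprD opprK -addrA e.
exists (c 0 0 *: p + c 0 i1 *: u), (c 0 0), (c 0 i1), (- c 0 i2), (- c 0 i3).
split=> //; apply: contra_neq c0 => x0.
have [c00 c01] := frame_free pf x0; rewrite xE in x0.
have [/eqP c02 /eqP c03] := frame_free pf' x0.
rewrite !oppr_eq0 in c02 c03.
apply/rowP => -[[|[|[|[|//]]]] i4]; rewrite mxE.
- by rewrite -[RHS]c00; congr (c 0 _); apply: val_inj.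
- by rewrite -[RHS]c01; congr (c 0 _); apply: val_inj.
- by rewrite -[RHS](eqP c02); congr (c 0 _); apply: val_inj.
- by rewrite -[RHS](eqP c03); congr (c 0 _); apply: val_inj.
Qed.

Lemma frame_null_comb p u x (a b : R) : frame p u -> x = a *: p + b *: u ->
  x != 0 -> q x x = 0 -> a != 0.
Proof.
move=> pf xE x0; rewrite (frame_norm_comb pf xE) => qx0.
apply: contra_neq x0 => a0; move/eqP: qx0.
rewrite a0 expr0n mulr0 add0r mulf_eq0 (gt_eqF (frame_gt0 pf)) sqrf_eq0 /=.
by move=> /eqP b0; rewrite xE a0 b0 !scale0r addr0.
Qed.

(** In the Lorentz case the common vector x is not lightlike: the bivectors
    x /\ p and x /\ p' are multiples of those of the two planes, so their product
    is zero; if x is lightlike, its real part is - s (x . p) (x . p'). But a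
    nonzero lightlike x is orthogonal to neither p nor p'. *)
Lemma frames_meet_neq0 p u p' u' x (a b c d : R) :
  frame p u -> frame p' u' -> sprod (P p u) (P p' u') = 0 ->
  x != 0 -> x = a *: p + b *: u -> x = c *: p' + d *: u' -> q x x != 0.
Proof.
move=> pf pf' PP x0 xE xE'; apply/eqP => qx0.
have a0 := frame_null_comb pf xE x0 qx0.
have c0 := frame_null_comb pf' xE' x0 qx0.
have [[pp pu u0] [pp' pu' u0']] := (pf, pf').
have pE : p = 1 *: p + 0 *: u by rewrite scale1r scale0r addr0.
have pE' : p' = 1 *: p' + 0 *: u' by rewrite scale1r scale0r addr0.
have /(congr1 fst) : sprod (P x p) (P x p') = 0.
  rewrite {1}xE {2}pE xE' {2}pE' !plucker_comb.
  by rewrite sprodZl sprodZr PP !mulr0.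
rewrite (sprod_plucker_re ss) qx0 mul0r sub0r.
have -> : q x p' = c * s.
  by rewrite xE' qformDl !qformZl pp' (qformC s u' p') pu' mulr0 addr0.
have -> : q p x = a * s by rewrite xE qformDr !qformZr pp pu mulr0 addr0.
move=> /eqP; rewrite mulrN oppr_eq0 !mulf_eq0 (negPf a0) (negPf c0) /= ?orbF ?orbb.
by case: s_pm => ->; rewrite ?oppr_eq0 oner_eq0.
Qed.

(** The geometric content of v . w = 0: the imaginary part gives a common vector
    x of the planes, and the real part says that the vectors w and w' completing
    x to orthogonal frames are orthogonal. In the Lorentz case x has to be a
    point of hyperbolic space: if x were spacelike, w and w' would be timelike,
    and two timelike vectors are never orthogonal. *)
Lemma frames_meet p u p' u' : frame p u -> frame p' u' ->
  sprod (P p u) (P p' u') = 0 ->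
  exists x w w', [/\ <<[:: p; u]>>%VS = <<[:: x; w]>>%VS,
    <<[:: p'; u']>>%VS = <<[:: x; w']>>%VS, 0 < s * q x x &
    [/\ q x w = 0, q x w' = 0, w != 0, w' != 0 & q w w' = 0]].
Proof.
move=> pf pf' PP.
have [x [a [b [c [d [x0 xE xE']]]]]] := frame_common pf pf' (congr1 snd PP).
have [uu uu'] := (frame_gt0 pf, frame_gt0 pf').
have qx0 := frames_meet_neq0 pf pf' PP x0 xE xE'.
have [w [spw xw ww Pw]] := frame_rotate pf xE qx0.
have [w' [spw' xw' ww' Pw']] := frame_rotate pf' xE' qx0.
have s0 : s != 0 by case: s_pm => ->; rewrite ?oppr_eq0 oner_eq0.
have w0 : w != 0.
  apply/eqP => w0; move: ww; rewrite w0 qform0l => /esym/eqP.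
  by rewrite !mulf_eq0 (gt_eqF uu) (negPf qx0) (negPf s0).
have w0' : w' != 0.
  apply/eqP => w'0; move: ww'; rewrite w'0 qform0l => /esym/eqP.
  by rewrite !mulf_eq0 (gt_eqF uu') (negPf qx0) (negPf s0).
have w_w' : q w w' = 0.
  have : (sprod (P x w) (P x w')).1 = 0.
    by rewrite Pw Pw' sprodZl sprodZr PP !mulr0.
  rewrite (sprod_plucker_re ss) xw' mul0r subr0 => /eqP.
  by rewrite !mulf_eq0 (negPf s0) (negPf qx0) => /eqP.
exists x, w, w'; split=> //.
case: s_pm => s1.
  rewrite [X in X * _]s1 mulN1r oppr_gt0; case: (ltgtP (q x x) 0) qx0 => // x_gt0 _.
  have w_gt0 : 0 < s * q w w by rewrite ww !mulrA ss mul1r mulr_gt0.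
  have := qform_orth_gt0 w_gt0 w_w' w0'.
  by rewrite ww' -mulrA [X in X * _]s1 mulN1r oppr_gt0 ltNge mulr_ge0 // ltW.
have : 0 <= q x x.
  rewrite (frame_norm_comb pf xE) [X in X * _]s1 mul1r.
  by rewrite addr_ge0 ?sqr_ge0 // mulr_ge0 ?sqr_ge0 // ltW.
by rewrite [X in X * _]s1 mul1r; case: ltgtP qx0.
Qed.
End Frames.

(** * Hyperbolic and elliptic lines *)

Section QuadricModel.
Variables (R : realType) (s : R).
Hypothesis s_pm : s = -1 \/ s = 1.
Implicit Types x y z w p u : 'rV[R]_4.
Local Notation A := (gcomplex s).
Local Notation q := (qform s).
Local Notation P := (@plucker R s).

Let ss : s * s = 1.
Proof. by case: s_pm => ->; rewrite ?mulrNN mulr1. Qed.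

Variables (X : geometry) (pt : pred 'rV[R]_4)
  (L : {vspace 'rV[R]_4} -> set (space_point R X)).
Implicit Types l m : set (space_point R X).

Definition pframe p u := [/\ pt p, q p u = 0 & u != 0].

(** What hyperbolic and elliptic space have in common: points are normalized
    vectors satisfying [pt], and [L] sends a plane of R^4 to the set of points
    it contains. The second alternative in [qm_same] is elliptic duality. *)
Record quadric_model : Prop := QuadricModel {
  qm_norm : forall p, pt p -> q p p = s;
  qm_scale : forall x, 0 < s * q x x -> exists2 c, c != 0 & pt (c *: x);
  qm_line : forall l,
    is_line l <-> exists p u, pframe p u /\ l = L <<[:: p; u]>>%VS;
  qm_orth : forall l m, meets_at_right_angle l m <->
    exists p u v, [/\ pframe p u, pframe p v, q u v = 0,
      l = L <<[:: p; u]>>%VS & m = L <<[:: p; v]>>%VS];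
  qm_pt : forall W W' x, L W = L W' -> pt x -> x \in W' -> x \in W;
  qm_same : forall p u p' u', pframe p u -> pframe p' u' ->
    same_skewer (L <<[:: p; u]>>%VS) (L <<[:: p'; u']>>%VS) ->
    L <<[:: p; u]>>%VS = L <<[:: p'; u']>>%VS \/
    [/\ q p p' = 0, q p u' = 0, q u p' = 0 & q u u' = 0] }.

Hypothesis qm : quadric_model.

Definition quadric_coord l (v : 'rV[A]_3) := exists (k : A) p u,
  [/\ k \is a GRing.unit, pframe p u, l = L <<[:: p; u]>>%VS & v = k *: P p u].

Lemma pframeW p u : pframe p u -> frame s p u.
Proof. by case=> /(qm_norm qm) ? ? ?; split. Qed.

(** A plane is determined by the points on it: if p' and u' are a frame of the
    second plane, then p' and a multiple of (1 + q u' u') p' + u' are points,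
    and they span the plane. *)
Lemma plucker_line p u p' u' :
  pframe p u -> pframe p' u' -> L <<[:: p; u]>>%VS = L <<[:: p'; u']>>%VS ->
  exists c, P p' u' = c *: P p u.
Proof.
move=> pf pf' e; have [ptp' pu' _] := pf'.
have uu' := frame_gt0 s_pm (pframeW pf').
have p'W' : p' \in <<[:: p'; u']>>%VS by rewrite memv_span ?mem_head.
have u'W' : u' \in <<[:: p'; u']>>%VS by rewrite memv_span // !inE eqxx orbT.
have p'W := qm_pt qm e ptp' p'W'.
pose y := (1 + q u' u') *: p' + u'.
have yy : 0 < s * q y y.
  (* The coefficient of p' is large enough for y to be timelike if s = -1. *)
  have -> : s * q y y = (1 + q u' u') ^+ 2 + s * q u' u'.
    rewrite !(qformDl, qformDr, qformZl, qformZr) (qm_norm qm ptp') (qformC s u') pu'.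
    by ring: ss.
  by case: s_pm => s1; rewrite [X in _ + X * _]s1; nra.
have [c c0 cy] := qm_scale qm yy.
have yW : y \in <<[:: p; u]>>%VS.
  rewrite -[y](scalerK c0) rpredZ //; apply: (qm_pt qm e cy).
  by rewrite rpredZ // rpredD // rpredZ.
have /mem_span2[a [b p'E]] := p'W.
have /mem_span2[a' [b' u'E]] : u' \in <<[:: p; u]>>%VS.
  by rewrite -[u'](addKr ((1 + q u' u') *: p')) rpredD // rpredN rpredZ.
by rewrite p'E u'E plucker_comb; eexists.
Qed.

Lemma span2_scale (c : R) x w : c != 0 ->
  <<[:: c *: x; w]>>%VS = <<[:: x; w]>>%VS.
Proof.
move=> c0; apply: (@span2_comb _ _ _ _ _ _ c 0 0 1);
  by rewrite ?scale1r ?scale0r ?addr0 ?add0r ?mulr1 ?mulr0 ?subr0.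
Qed.

Lemma quadric_orth l m (v w : 'rV[A]_3) :
  quadric_coord l v -> quadric_coord m w ->
  meets_at_right_angle l m <-> sprod v w = 0.
Proof.
move=> [k [p [u [Uk pf -> ->]]]] [k' [p' [u' [Uk' pf' -> ->]]]].
split.
  move=> /(qm_orth qm)[x [w1 [w2 [xf xf' w12 e1 e2]]]].
  have [c ->] := plucker_line xf pf (esym e1).
  have [c' ->] := plucker_line xf' pf' (esym e2).
  rewrite !sprodZl !sprodZr.
  suff -> : sprod (P x w1) (P x w2) = 0 by rewrite !mulr0.
  have [_ xw1 _] := xf; have [_ xw2 _] := xf'.
  by rewrite (sprod_plucker_common ss) w12 xw2 mulr0 mul0r subrr mulr0.
rewrite sprodZl sprodZr => /(mul_unit0 Uk)/(mul_unit0 Uk') PP.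
have [x [w1 [w2 [sp sp' xx [xw xw' w0 w0' ww]]]]] :=
  frames_meet s_pm (pframeW pf) (pframeW pf') PP.
suff [d [d0 xf xf']] :
    exists d, [/\ d != 0, pframe (d *: x) w1 & pframe (d *: x) w2].
  apply/(qm_orth qm); exists (d *: x), w1, w2.
  by rewrite sp sp' !span2_scale.
have [d d0 dx] := qm_scale qm xx; exists d; split=> //; split=> //.
  by rewrite qformZl xw mulr0.
by rewrite qformZl xw' mulr0.
Qed.

(** For a direction a and a moment b orthogonal to it, the line passes through
    the point with homogeneous coordinates (a . a, a x b), with tangent vector
    (0, a) there. *)
Lemma frame_of_coordinates (v : 'rV[A]_3) : sprod v v \is a GRing.unit ->
  exists k p u, [/\ k \is a GRing.unit, 0 < s * q p p, q p u = 0, u != 0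
    & v = k *: P p u].
Proof.
move=> Uv.
have s_cases : [\/ s = -1, s = 0 | s = 1].
  by case: s_pm => ?; [apply: Or31 | apply: Or33].
have [k [a [b [Uk -> a0 ab r0]]]] := gvec_normalize s_cases Uv.
have aa : 0 < sprod a a by rewrite sprod_gt0.
pose p := row4 (sprod a a) (cross a b); pose u := row4 0 a.
have Ug : gc s (sprod a a)^-1 0 \is a GRing.unit.
  by rewrite gcunitE gnormE expr0n mulr0 subr0 sqrf_eq0 invr_eq0 gt_eqF.
exists (k * gc s (sprod a a)^-1 0), p, u; split.
- by rewrite unitrM Uk.
- rewrite /qform !row4_0 spatial_row4 lagrange ab expr0n subr0.
  rewrite (_ : s * _ = sprod a a * (sprod a a + s * sprod b b)); last by ring: ss.
  by rewrite mulr_gt0.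
- by rewrite /qform !row4_0 !spatial_row4 mulr0 mulr0 add0r sprodC sprod_crossl.
- apply: contra_neq a0 => u0; rewrite -(spatial_row4 0 a) -/u u0.
  by apply/rowP => i; rewrite !mxE.
- rewrite -scalerA; congr (k *: _).
  rewrite scale_gvec mulr0 !scale0r !addr0 !row4_0 !spatial_row4.
  rewrite scale0r subr0 scalerA mulVf ?gt_eqF // scale1r crossC bac_cab ab scale0r.
  by rewrite sub0r opprK scalerA mulVf ?gt_eqF // scale1r.
Qed.

Lemma quadric_coordinates : line_coordinates quadric_coord.
Proof.
split.
- move=> l /(qm_line qm)[p [u [pf ->]]]; exists (P p u), 1, p, u.
  by rewrite scale1r unitr1.
- move=> l v [k [p [u [Uk pf _ ->]]]]; have [_ pu _] := pf.
  rewrite sprodZl sprodZr (sprod_plucker_common ss) pu mul0r subr0.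
  rewrite (qm_norm qm) ?mulrA ?ss ?mul1r; last by case: pf.
  rewrite !unitrM Uk gcunitE gnormE expr0n mulr0 subr0 sqrf_eq0.
  by rewrite gt_eqF // (frame_gt0 s_pm (pframeW pf)).
- move=> v /frame_of_coordinates[k [p [u [Uk pp pu u0 ->]]]].
  have [c c0 cp] := qm_scale qm pp.
  have cf : pframe (c *: p) u by split=> //; rewrite qformZl pu mulr0.
  exists (L <<[:: c *: p; u]>>%VS); first by apply/(qm_line qm); exists (c *: p), u.
  exists (k * gc s c^-1 0), (c *: p), u; split=> //.
    by rewrite unitrM Uk gcunitE gnormE expr0n mulr0 subr0 sqrf_eq0 invr_eq0.
  have -> : P (c *: p) u = gc s c 0 *: P p u.
    have := plucker_comb s p u c 0 0 1.
    by rewrite !scale0r !add0r addr0 scale1r mulr1 mulr0 subr0.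
  by rewrite scalerA -mulrA gcM mulVf // !mulr0 mul0r !addr0 (_ : gc s 1 0 = 1) // mulr1.
- exact: quadric_orth.
- move=> l m v w [k [p [u [_ pf -> ->]]]] [k' [p' [u' [_ pf' -> ->]]]].
  move=> /(qm_same qm pf pf')[/(plucker_line pf pf')[c ->] | [pp pu up uu]].
    by rewrite !crossZl !crossZr crossvv !scaler0.
  by rewrite crossZl crossZr (cross_plucker_orth ss pp pu up uu) !scaler0.
Qed.
End QuadricModel.

Section HyperbolicModel.
Variable R : realType.
Implicit Types x y p u : 'rV[R]_4.
Local Open Scope classical_set_scope.

Lemma lorentzE x y : lorentz x y = qform (-1) x y.
Proof.
rewrite /lorentz /qform mulN1r; congr (_ + _).
rewrite big_mkcond big_ord_recl /= add0r.
by apply: eq_bigr => i _; rewrite !mxE.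
Qed.

Definition hyperboloid_pt x := (lorentz x x == -1) && (0 < x 0 0).

Definition hyperbolic_section (W : {vspace 'rV[R]_4}) :
    set (space_point R Hyperbolic) := [set x : hyperboloid R | val x \in W].

Lemma hyperbolic_model :
  quadric_model (-1) hyperboloid_pt hyperbolic_section.
Proof.
split.
- by move=> p /andP[/eqP]; rewrite lorentzE.
- move=> x; rewrite mulN1r oppr_gt0 => xx.
  have x0 : x 0 0 != 0.
    apply: contraTneq xx => x0; rewrite /qform x0 mulr0 mulr0 add0r -leNgt.
    exact: sprod_ge0.
  set t := - qform (-1) x x; have t0 : 0 < t by rewrite oppr_gt0.
  (* The sign puts the multiple of x on the upper sheet. *)
  exists (Num.sg (x 0 0) / Num.sqrt t).
    by rewrite mulf_neq0 ?sgr_eq0 // invr_eq0 gt_eqF // sqrtr_gt0.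
  apply/andP; split.
    rewrite lorentzE qformZl qformZr mulrA -expr2 exprMn sqr_sg x0 mul1r exprVn.
    by rewrite sqr_sqrtr ?ltW // -[qform _ _ _]opprK -/t mulrN mulVf ?(gt_eqF t0).
  by rewrite mxE mulrAC -normrEsg divr_gt0 ?normr_gt0 ?sqrtr_gt0.
- move=> l; split=> [[p [u [pu u0 ->]]]|[p [u [[ptp pu u0] ->]]]].
    exists (val p), u; split=> //; split=> //; first exact: valP.
    by rewrite -lorentzE.
  exists (exist _ p ptp), u; split=> //.
  by rewrite /hyperbolic_tangent lorentzE.
- move=> l m; split=> [[p [u [v [[pu u0] [pv v0] uv -> ->]]]]|].
    by exists (val p), u, v; split=> //;
      first [split=> //; [exact: valP | by rewrite -lorentzE] | by rewrite -lorentzE].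
  move=> [p [u [v [[ptp pu u0] [_ pv v0] uv -> ->]]]].
  exists (exist _ p ptp), u, v; split=> //; rewrite /hyperbolic_tangent ?lorentzE //.
- by move=> W W' x e ptx xW'; have : hyperbolic_section W (exist _ x ptx) by rewrite e.
- by move=> p u p' u' _ _ /= e; left.
Qed.
End HyperbolicModel.

Section EllipticModel.
Variable R : realType.
Implicit Types (x y p u : 'rV[R]_4) (W : {vspace 'rV[R]_4}).
Local Open Scope classical_set_scope.

Lemma dot4E x y : dot x y = qform 1 x y.
Proof.
rewrite /dot /qform mul1r big_ord_recl; congr (_ + _).
by apply: eq_bigr => i _; rewrite !mxE.
Qed.

Definition sphere_pt x := dot x x == 1.

Lemma RP3_pi_eq (x y : sphere3 R) :
  RP3_pi x = RP3_pi y -> val x = val y \/ val x = - val y.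
Proof. by move=> /eqmodP/orP[] /eqP; [left|right]. Qed.

Lemma sphere_scale x : 0 < qform 1 x x -> exists2 c, c != 0 & sphere_pt (c *: x).
Proof.
move=> xx; exists (Num.sqrt (qform 1 x x))^-1.
  by rewrite invr_eq0 gt_eqF // sqrtr_gt0.
rewrite /sphere_pt dot4E qformZl qformZr mulrA -expr2 exprVn sqr_sqrtr ?ltW //.
by rewrite mulVf // gt_eqF.
Qed.

Lemma projectivization_mem W (x : sphere3 R) :
  projectivization W (RP3_pi x) -> val x \in W.
Proof. by case=> y /= yW /RP3_pi_eq[<- // | yx]; rewrite -[val x]opprK -yx rpredN. Qed.

Lemma elliptic_line_frame W : \dim W = 2 ->
  exists p u, [/\ sphere_pt p, qform 1 p u = 0, u != 0 & W = <<[:: p; u]>>%VS].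
Proof.
move=> dW; have := vbasisP W.
case/andP => /eqP; move: (vbasis W); rewrite dW => -[[|x [|y []]] //= _] <-.
rewrite free_cons seq1_free span_seq1 => /andP[xy y0].
have xx : 0 < qform 1 x x.
  apply: qform1_gt0; apply: contraNneq xy => ->; exact: mem0v.
have [c c0 cx] := sphere_scale xx.
have cc : qform 1 (c *: x) (c *: x) = 1 by rewrite -dot4E; apply/eqP.
set k := qform 1 (c *: x) y.
exists (c *: x), (y - k *: (c *: x)); split=> //.
- by rewrite -scaleNr qformDr qformZr cc mulr1 subrr.
- rewrite subr_eq0; apply: contraNneq xy => yE.
  have kc0 : k * c != 0 by apply: contra_neq y0 => kc; rewrite yE scalerA kc scale0r.
  by apply/vlineP; exists (k * c)^-1; rewrite yE scalerA scalerA mulVf // scale1r.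
- apply: esym; apply: (@span2_comb _ _ _ _ _ _ c 0 (- (k * c)) 1).
  + by rewrite scale0r addr0.
  + by rewrite scaleNr scalerA scale1r addrC.
  + by rewrite mulr1 mul0r subr0.
Qed.

Lemma dim_frame p u : sphere_pt p -> qform 1 p u = 0 -> u != 0 ->
  \dim <<[:: p; u]>> = 2.
Proof.
move=> /eqP; rewrite dot4E => pp pu u0; apply/eqP.
rewrite -[2%N]/(size [:: p; u]) -/(free _) free_cons seq1_free u0 andbT span_seq1.
apply/negP => /vlineP[k pE]; move: pu (qform1_gt0 u0); rewrite pE qformZl => /eqP.
rewrite mulf_eq0 => /orP[/eqP k0 _|/eqP -> //]; last by rewrite ltxx.
by move: pp; rewrite pE k0 scale0r qform0l => /eqP; rewrite eq_sym oner_eq0.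
Qed.

(** The dual line is defined through unit vectors, but these span the plane. *)
Lemma dual_line_orth W W' x y :
  projectivization W = dual_line (projectivization W') ->
  x \in W -> y \in W' -> qform 1 x y = 0.
Proof.
move=> e xW yW'.
have [->|x0] := eqVneq x 0; first exact: qform0l.
have [->|y0] := eqVneq y 0; first by rewrite qformC qform0l.
have [c c0 cx] := sphere_scale (qform1_gt0 x0).
have [d d0 dy] := sphere_scale (qform1_gt0 y0).
pose X : sphere3 R := exist _ (c *: x) cx.
pose Y : sphere3 R := exist _ (d *: y) dy.
have : projectivization W (RP3_pi X) by exists X => //=; rewrite rpredZ.
rewrite e => -[Z Zorth ZX].
have {Zorth} : dot (val Y) (val Z) = 0 by apply: Zorth; exists Y => //=; rewrite rpredZ.
have : val Z = c *: x \/ val Z = - (c *: x) := RP3_pi_eq ZX.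
rewrite dot4E /= qformZl => -[] ->; rewrite -?scaleNr qformZr qformC => /eqP;
  by rewrite !mulf_eq0 ?oppr_eq0 (negPf c0) (negPf d0) => /eqP.
Qed.

Lemma elliptic_model :
  @quadric_model R 1 Elliptic sphere_pt (@projectivization R).
Proof.
split.
- by move=> p /eqP; rewrite dot4E.
- by move=> x; rewrite mul1r; exact: sphere_scale.
- move=> l; split=> [[W [/elliptic_line_frame[p [u [ptp pu u0 ->]]] ->]]|].
    by exists p, u.
  by move=> [p [u [[ptp pu u0] ->]]]; exists <<[:: p; u]>>%VS; rewrite dim_frame.
- move=> l m; split=> [[p [u [v [[pu u0] [pv v0] uv -> ->]]]]|].
    by exists (val p), u, v; split=> //;
      first [split=> //; [exact: valP | by rewrite -dot4E] | by rewrite -dot4E].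
  move=> [p [u [v [[ptp pu u0] [_ pv v0] uv -> ->]]]].
  exists (exist _ p ptp), u, v; split=> //; rewrite /elliptic_tangent ?dot4E //.
- move=> W W' x e ptx xW'; pose X : sphere3 R := exist _ x ptx.
  by apply: (@projectivization_mem W X); rewrite e; exists X.
- move=> p u p' u' pf pf' [e|e]; [by left | right].
  have mem2 (a b : 'rV[R]_4) : a \in <<[:: a; b]>>%VS /\ b \in <<[:: a; b]>>%VS.
    by rewrite !memv_span // !inE eqxx ?orbT.
  by have [[? ?] [? ?]] := (mem2 p u, mem2 p' u'); split; apply: dual_line_orth e _ _.
Qed.
End EllipticModel.

(** * The three geometries together *)

Lemma line_coordinates_exist (R : realType) (X : geometry) :
  exists (A : comUnitRingType)
    (coord : set (space_point R X) -> 'rV[A]_3 -> Prop),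
    line_coordinates coord /\ has_unit_preserving_annihilators A.
Proof.
have pack (s : R) (coord : set (space_point R X) -> 'rV[gcomplex s]_3 -> Prop) :
    line_coordinates coord -> exists (A : comUnitRingType)
      (coord : set (space_point R X) -> 'rV[A]_3 -> Prop),
      line_coordinates coord /\ has_unit_preserving_annihilators A.
  move=> lc; exists (gcomplex s), coord.
  by split; [exact: lc | exact: gc_annihilators].
case: X pack => pack.
- exact: pack (euclidean_coordinates R).
- exact: pack (@quadric_coordinates R (-1) (or_introl erefl) _ _ _
    (@hyperbolic_model R)).
- exact: pack (@quadric_coordinates R 1 (or_intror erefl) _ _ _
    (@elliptic_model R)).
Qed.

Theorem theorem3 (R : realType) (X : geometry)
    (a1 a2 a3 b1 b2 b3 : set (space_point R X))
    (s1 s2 s3 : set (space_point R X))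
    (p12 p13 p23 q12 q13 q23 : set (space_point R X))
    (c12 c13 c23 : set (space_point R X))
    (line_a : [/\ is_line a1, is_line a2 & is_line a3])
    (line_b : [/\ is_line b1, is_line b2 & is_line b3])
    (S_s : [/\ is_S a1 b1 s1, is_S a2 b2 s2 & is_S a3 b3 s3])
    (S_p : [/\ is_S a1 a2 p12, is_S a1 a3 p13 & is_S a2 a3 p23])
    (S_q : [/\ is_S b1 b2 q12, is_S b1 b3 q13 & is_S b2 b3 q23])
    (S_c : [/\ is_S p12 q12 c12, is_S p13 q13 c13 & is_S p23 q23 c23])
    (S_conclusion : [\/ has_unique_skewer c12 c13, has_unique_skewer c12 c23
                      | has_unique_skewer c13 c23])
    (share_s : share_skewer s1 s2 s3) :
  share_skewer c12 c13 c23.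
Proof.
have [A [coord [lc ann]]] := line_coordinates_exist R X.
exact (skewer_desargues lc ann line_a line_b S_s S_p S_q S_c
  S_conclusion share_s).
Qed.
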